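(* Let $c>0$, and let $(\varepsilon_0(n))_{n\ge 1}$ be positive reals with $e^{\varepsilon_0(n)}/n\to c^2\in(0,\infty)$. Put $\delta_n:=1/(1+e^{\varepsilon_0(n)})$. Let $P_n$ be the law $\mathrm{Bin}(n,\delta_n)$, and let $Q_n$ be the law of the sum of two independent random variables distributed as $\mathrm{Bin}(n-1,\delta_n)$ and $\mathrm{Bern}(1-\delta_n)$. Let $\lambda:=c^{-2}$ and let $$(P_\infty,Q_\infty):=\bigl(\mathrm{Poi}(\lambda),\,1+\mathrm{Poi}(\lambda)\bigr),$$ where $1+\mathrm{Poi}(\lambda)$ is the law of $1+J$ with $J\sim\mathrm{Poi}(\lambda)$. Then $\Delta\bigl((P_n,Q_n),(P_\infty,Q_\infty)\bigr)\to 0$ as $n\to\infty$. Moreover, with $\lambda_n:=n\delta_n$ and $\lambda_{n-1}:=(n-1)\delta_n$, one has $$\mathrm{TV}(P_n,P_\infty)\le n\delta_n(1-e^{-\delta_n})+|\lambda_n-\lambda|\le n\delta_n^2+|\lambda_n-\lambda|,$$ $$\mathrm{TV}(Q_n,Q_\infty)\le \delta_n+(n-1)\delta_n(1-e^{-\delta_n})+|\lambda_{n-1}-\lambda|\le \delta_n+(n-1)\delta_n^2+|\lambda_{n-1}-\lambda|.$$ Consequently, $$\Delta\bigl((P_n,Q_n),(P_\infty,Q_\infty)\bigr)\le \max\{\mathrm{TV}(P_n,P_\infty),\mathrm{TV}(Q_n,Q_\infty)\}.$$ In particular, in the canonical calibration $e^{\varepsilon_0(n)}=c^2n$ (equivalently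 $\delta_n=(1+c^2n)^{-1}$), $$\Delta\bigl((P_n,Q_n),(P_\infty,Q_\infty)\bigr)\le \frac{2}{c^2n}+\frac{2}{c^4n}.$$
   Context: $\mathrm{TV}(\mu,\nu):=\sup_A|\mu(A)-\nu(A)|$ is total variation distance. A binary experiment is an ordered pair of probability measures on a common measurable space. For binary experiments $(P,Q)$ and $(P',Q')$, the deficiency of the first relative to the second is $\inf_K\max\{\mathrm{TV}(PK,P'),\mathrm{TV}(QK,Q')\}$, the infimum over Markov kernels $K$ between the sample spaces; the Le Cam distance $\Delta\bigl((P,Q),(P',Q')\bigr)$ is the maximum of the two deficiencies (each experiment relative to the other). Interpretation: $P_n$ and $Q_n$ are the laws of the number $K_n$ of output-1 messages when $n$ users apply binary randomized response (flip probability $\delta_n$) independently and the messages are shuffled, for the dataset of all zeros and the dataset with exactly one one, respectively. *)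

(* Defs.v *)
From HB Require Import structures.
From mathcomp Require Import all_boot all_order all_algebra.
From mathcomp Require Import all_classical all_reals all_analysis.

Set Implicit Arguments.
Unset Strict Implicit.
Unset Printing Implicit Defensive.

Import Order.TTheory GRing.Theory Num.Theory.
Import numFieldNormedType.Exports.

Local Open Scope classical_set_scope.
Local Open Scope ring_scope.

(* The supremum is taken over a nonempty subset of [0, 1], so the real-valued
   [sup] is the genuine least upper bound. *)
Definition tv d (T : measurableType d) (R : realType)
    (mu nu : probability T R) : R :=
  sup [set `|fine (mu A) - fine (nu A)| | A in @measurable d T].

Section kernel_image.
Context d d' (X : measurableType d) (Y : measurableType d') (R : realType).
Variables (P : probability X R) (K : R.-pker X ~> Y).
Local Open Scope ereal_scope.

Definition kernel_image (A : set Y) : \bar R := \int[P]_x K x A.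

Let kernel_image0 : kernel_image set0 = 0.
Proof. by apply: integral0_eq => x _; rewrite measure0. Qed.

Let kernel_image_ge0 A : 0 <= kernel_image A.
Proof. by apply: integral_ge0 => x _; exact: measure_ge0. Qed.

Let kernel_image_sigma_additive : semi_sigma_additive kernel_image.
Proof.
move=> U mU tU mUU; rewrite [X in _ --> X](_ : _ =
  \int[P]_x (\sum_(n <oo) K x (U n))); last first.
  apply: eq_integral => x _.
  by apply/esym/cvg_lim => //; exact/measure_semi_sigma_additive.
apply/cvg_closeP; split.
  by apply: is_cvg_nneseries => n _ _; exact: integral_ge0.
rewrite closeE// integral_nneseries// => n.
exact: measurable_kernel.
Qed.

HB.instance Definition _ := isMeasure.Build _ _ _ kernel_image
  kernel_image0 kernel_image_ge0 kernel_image_sigma_additive.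

Let kernel_image_setT : kernel_image [set: Y] = 1.
Proof.
rewrite /kernel_image; under eq_integral do rewrite prob_kernel.
rewrite integral_cst//; exact: etrans (mul1e _) (probability_setT P).
Qed.

HB.instance Definition _ :=
  Measure_isProbability.Build _ _ _ kernel_image kernel_image_setT.

End kernel_image.

Definition experiment d (T : measurableType d) (R : realType) : Type :=
  (probability T R * probability T R)%type.

(* The infimum is over a set that is bounded below by 0 and nonempty (it
   contains the value at a constant kernel), so the real-valued [inf] is the
   genuine greatest lower bound. *)
Definition deficiency d d' (X : measurableType d) (Y : measurableType d')
    (R : realType) (E : experiment X R) (F : experiment Y R) : R :=
  inf [set Num.max (tv (kernel_image E.1 K) F.1) (tv (kernel_image E.2 K) F.2)
      | K in [set: R.-pker X ~> Y]].

Definition le_cam d d' (X : measurableType d) (Y : measurableType d')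
    (R : realType) (E : experiment X R) (F : experiment Y R) : R :=
  Num.max (deficiency E F) (deficiency F E).

Definition add_bool (z : nat * bool) : nat := (z.1 + z.2)%N.

Lemma measurable_add_bool : measurable_fun [set: nat * bool] add_bool.
Proof.
apply: measurable_realfun.measurable_fun_addn => //.
by apply: (@measurableT_comp _ _ _ _ _ _ nat_of_bool) => //.
Qed.

HB.instance Definition _ :=
  isMeasurableFun.Build _ _ _ _ add_bool measurable_add_bool.

Lemma measurable_succn : measurable_fun [set: nat] succn.
Proof. by []. Qed.

HB.instance Definition _ := isMeasurableFun.Build _ _ _ _ succn measurable_succn.

Section shuffle.
Context (R : realType).

Definition flip_prob (eps : R) : R := (1 + expR eps)^-1.

Definition law0 (n : nat) (delta : R) : probability nat R :=
  binomial_prob n delta.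

(* The law of the sum of two independent variables is the image under addition
   of the product of their laws; [bool] is identified with {0, 1}. *)
Definition law1 (n : nat) (delta : R) : probability nat R :=
  distribution (binomial_prob n.-1 delta \x bernoulli_prob (1 - delta))%E
    add_bool.

(* The last argument of [poisson_prob] is a dummy. *)
Definition poisson_law (lambda : R) : probability nat R :=
  poisson_prob lambda 0%N.

Definition shifted_poisson_law (lambda : R) : probability nat R :=
  distribution (poisson_law lambda) succn.

End shuffle.

(* Main.v *)
Require Import Defs.
From HB Require Import structures.
From mathcomp Require Import all_boot all_order all_algebra.
From mathcomp Require Import all_classical all_reals all_analysis.
From mathcomp Require Import zify ring lra.

Set Implicit Arguments.
Unset Strict Implicit.
Unset Printing Implicit Defensive.

Import Order.TTheory GRing.Theory Num.Theory.
Import numFieldNormedType.Exports.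

Local Open Scope classical_set_scope.
Local Open Scope ring_scope.

(**
The identity kernel bounds both deficiencies by total variation distances, so
only those matter. Total variation is subadditive under convolution of laws on
[nat]; the laws [Bin(n, p)] and [Poi(n p)] are [n]-fold convolutions of
[Bern(p)] and [Poi(p)], which are at distance [p (1 - exp (- p))], and
[Poi(a + b)] is the convolution of [Poi(a)] with [Poi(b)], itself within [b] of
the Dirac mass at 0. Convolving further with [Bern(1 - p)], respectively the
Dirac mass at 1, costs an additional [p] for the second pair of laws.
*)

(** * Total variation and its one-sided form *)

Section total_variation.
Context d (T : measurableType d) (R : realType).
Implicit Types (mu nu : probability T R) (e : R).

Let tv_set mu nu := [set `|fine (mu A) - fine (nu A)| | A in @measurable d T].

Let fine_prob01 mu A : measurable A -> 0 <= fine (mu A) <= 1.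
Proof.
move=> mA; rewrite -!lee_fin fineK ?fin_num_measure//.
by rewrite measure_ge0 probability_le1.
Qed.

Let has_ubound_tv_set mu nu : has_ubound (tv_set mu nu).
Proof.
exists 1 => _ [A mA <-].
have /andP[? ?] := fine_prob01 mu mA; have /andP[? ?] := fine_prob01 nu mA.
by rewrite ler_norml; apply/andP; split; lra.
Qed.

Lemma tv_ge0 mu nu : 0 <= tv mu nu.
Proof.
apply: (ub_le_sup (has_ubound_tv_set mu nu)); exists set0.
  exact: measurable0.
by rewrite !measure0 subrr normr0.
Qed.

Lemma tv_sym mu nu : tv mu nu = tv nu mu.
Proof.
by rewrite /tv; congr sup; apply: eq_imagel => A _; rewrite distrC.
Qed.

(* By complementation, the one-sided bound is equivalent to its two-sided
   version; being free of subtraction, it is stable under integration. *)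
Definition tv_le mu nu e := forall A, measurable A -> (mu A <= nu A + e%:E)%E.

Lemma tv_le_sym mu nu e : tv_le mu nu e -> tv_le nu mu e.
Proof.
move=> H A mA; have := H _ (measurableC mA).
rewrite !probability_setC// -(fineK (fin_num_measure mu A mA)).
rewrite -(fineK (fin_num_measure nu A mA)) -!EFinB -!EFinD !lee_fin; lra.
Qed.

Lemma tv_le_tv mu nu e : tv_le mu nu e -> tv mu nu <= e.
Proof.
move=> H; apply: ge_sup.
  by exists `|fine (mu set0) - fine (nu set0)|, set0 => //; exact: measurable0.
move=> _ [A mA <-]; have := H A mA; have := tv_le_sym H mA.
rewrite -(fineK (fin_num_measure mu A mA)) -(fineK (fin_num_measure nu A mA)).
rewrite -!EFinD !lee_fin /= => ? ?.
by rewrite ler_norml; apply/andP; split; lra.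
Qed.

Lemma tv_le_trans mu nu rho e f :
  tv_le mu nu e -> tv_le nu rho f -> tv_le mu rho (e + f).
Proof.
move=> H K A mA; apply: le_trans (H A mA) _.
by rewrite (addrC e) EFinD addeA leeD2r// K.
Qed.

End total_variation.


(** * Le Cam distance on a common sample space *)

Section le_cam_bound.
Context d (T : measurableType d) (R : realType).
Implicit Types (E F : experiment T R).

Let kernel_image_id (P : probability T R) A : measurable A ->
  kernel_image P (kdirac (@measurable_id _ T setT)) A = P A.
Proof.
move=> mA; rewrite /kernel_image /kdirac/=.
by rewrite -[X in _ = P X](setIT A) -integral_indic.
Qed.

Lemma deficiency_ge0 E F : 0 <= deficiency E F.
Proof.
apply: lb_le_inf.
  by eexists; exists (kdirac (@measurable_id _ T setT)).
by move=> _ [K _ <-]; rewrite le_max tv_ge0.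
Qed.

Lemma deficiency_le_tv E F :
  deficiency E F <= Num.max (tv E.1 F.1) (tv E.2 F.2).
Proof.
apply: ge_inf.
  by exists 0 => _ [K _ <-]; rewrite le_max tv_ge0.
exists (kdirac (@measurable_id _ T setT)) => //.
by congr Num.max; rewrite /tv; congr sup; apply: eq_imagel => A mA;
  congr `|fine _ - _|;
  exact: kernel_image_id.
Qed.

Lemma le_cam_ge0 E F : 0 <= le_cam E F.
Proof. by rewrite le_max deficiency_ge0. Qed.

Lemma le_cam_le_tv E F : le_cam E F <= Num.max (tv E.1 F.1) (tv E.2 F.2).
Proof.
rewrite ge_max deficiency_le_tv/= (tv_sym E.1) (tv_sym E.2).
exact: deficiency_le_tv.
Qed.

End le_cam_bound.

(** * Convolution of laws on [nat] *)

Definition addn_pair (z : nat * nat) : nat := (z.1 + z.2)%N.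

Lemma measurable_addn_pair : measurable_fun [set: nat * nat] addn_pair.
Proof. exact: measurable_realfun.measurable_fun_addn. Qed.

HB.instance Definition _ :=
  isMeasurableFun.Build _ _ _ _ addn_pair measurable_addn_pair.

Section convolution.
Context (R : realType).
Implicit Types (mu nu rho : probability nat R) (e f : R).
Local Open Scope ereal_scope.

Definition nat_conv mu nu : probability nat R :=
  distribution (mu \x nu) addn_pair.

Lemma nat_convEl mu nu A :
  nat_conv mu nu A = \int[mu]_x nu [set y | A (x + y)%N].
Proof.
apply: eq_integral => x _; congr (nu _).
by apply/seteqP; split => y; rewrite /xsection/= inE.
Qed.

(** The product [\x] integrates over its first factor outermost. Uniqueness of the product measure
    identifies it with [\x^], which puts the second factor outermost; this is the form needed to
    vary the left factor of a convolution. *)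
Lemma nat_convEr mu nu A :
  nat_conv mu nu A = \int[nu]_y mu [set x | A (x + y)%N].
Proof.
rewrite /nat_conv/distribution/pushforward/=.
rewrite (@product_measure_unique _ _ _ _ _ mu nu (mu \x^ nu)).
- apply: eq_integral => y _; congr (mu _).
  by apply/seteqP; split => x; rewrite /ysection/= inE.
- by move=> B C mB mC; exact: product_measure2E.
- by rewrite -[X in measurable X]setTI; exact: measurable_addn_pair.
Qed.

Let integral_add_cst mu (g : nat -> \bar R) e : (forall x, 0 <= g x) ->
  (0 <= e)%R -> \int[mu]_x (g x + e%:E) = \int[mu]_x g x + e%:E.
Proof.
move=> g0 e0; rewrite ge0_integralD//.
congr +%E; rewrite integral_cst//.
exact: etrans (congr1 _ (probability_setT mu)) (mule1 _).
Qed.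

(** The one-sided bound holds for every translate of [A]; integrating it against the probability
    [rho] leaves the constant [e] unchanged. *)
Lemma tv_le_nat_convr mu nu rho e : (0 <= e)%R ->
  tv_le mu nu e -> tv_le (nat_conv rho mu) (nat_conv rho nu) e.
Proof.
move=> e0 H A _; rewrite !nat_convEl -integral_add_cst//.
by apply: ge0_le_integral => // x _; exact: H.
Qed.

Lemma tv_le_nat_convl mu nu rho e : (0 <= e)%R ->
  tv_le mu nu e -> tv_le (nat_conv mu rho) (nat_conv nu rho) e.
Proof.
move=> e0 H A _; rewrite !nat_convEr -integral_add_cst//.
by apply: ge0_le_integral => // x _; exact: H.
Qed.

(** The factors are replaced one at a time, through [nat_conv nu mu']. *)
Lemma tv_le_nat_conv mu nu mu' nu' e f : (0 <= e)%R -> (0 <= f)%R ->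
  tv_le mu nu e -> tv_le mu' nu' f ->
  tv_le (nat_conv mu mu') (nat_conv nu nu') (e + f).
Proof.
move=> e0 f0 H K; apply: (@tv_le_trans _ _ _ _ (nat_conv nu mu')).
  exact: tv_le_nat_convl.
exact: tv_le_nat_convr.
Qed.

Lemma nat_conv_set1 mu nu n :
  nat_conv mu nu [set n] =
  \sum_(k < n.+1) mu [set (k : nat)] * nu [set (n - k)%N].
Proof.
rewrite /nat_conv/distribution/pushforward/=.
(* The preimage of a point is a finite antidiagonal, a disjoint union of one-point rectangles. *)
have -> : addn_pair @^-1` [set n] =
    \big[setU/set0]_(k < n.+1) ([set (k : nat)] `*` [set (n - k)%N]).
  rewrite -(bigcup_mkord n.+1 (fun k => [set k] `*` [set (n - k)%N])).
  apply/seteqP; split => [[x y]/= xyn|[x y]/= [k/= kn [/= -> ->]]].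
    exists x => /=; first by rewrite ltnS -xyn leq_addr.
    by split => //=; rewrite -xyn addKn.
  by rewrite /addn_pair/= subnKC.
rewrite measure_bigsetU_ord//=.
- by apply: eq_bigr => k _; rewrite product_measure1E.
- by move=> k; exact: measurableX.
- by move=> i j _ _ [[x y]/= [[/= -> _] [/= ij _]]]; exact/val_inj.
Qed.

(** Every set of naturals is a countable disjoint union of singletons, so point masses determine the
    law. *)
Lemma eq_prob_nat mu nu : (forall n, mu [set n] = nu [set n]) -> mu =1 nu.
Proof.
have series rho A : rho A = \sum_(n <oo | n \in A) rho [set n].
  rewrite -[in LHS](image_id A) -bigcup_imset1 measure_bigcup//.
  by move=> i j _ _ [x [/= -> ->]].
by move=> munu A; rewrite !series; apply: eq_eseriesr => n _.
Qed.

End convolution.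

Lemma eq_tv_le d (T : measurableType d) (R : realType)
    (mu mu' nu nu' : probability T R) e :
  mu =1 mu' -> nu =1 nu' -> tv_le mu nu e -> tv_le mu' nu' e.
Proof. by move=> mumu' nunu' H A mA; rewrite -mumu' -nunu'; exact: H. Qed.

(** * Binomial, Bernoulli and Poisson laws *)

Section distributions.
Context (R : realType).
Implicit Types (p a b : R) (n m k : nat).

Lemma law0_set1 n p k : 0 <= p <= 1 ->
  law0 n p [set k] = (binomial_pmf n p k)%:E.
Proof.
move=> p01; rewrite /law0/= /binomial_prob p01 esum_set1//.
by rewrite lee_fin binomial_pmf_ge0.
Qed.

Lemma poisson_law_set1 a k : 0 <= a ->
  poisson_law a [set k] = (a ^+ k / k`!%:R * expR (- a))%:E.
Proof.
(* At rate 0 [poisson_prob] falls back to the Dirac mass at 0, which agrees with the formula because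
   [0 ^+ 0 = 1]. *)
rewrite le_eqVlt => /orP[/eqP<-|a0].
  rewrite /poisson_law/= /poisson_prob ltxx oppr0 expR0 mulr1 diracE in_set1.
  by case: k => [|k]; rewrite ?expr0n ?divr1// mul0r.
rewrite /poisson_law/= /poisson_prob a0 esum_set1 ?lee_fin ?poisson_pmf_ge0//.
by rewrite /poisson_pmf a0.
Qed.

Lemma nat_conv_binomial n m p : 0 <= p <= 1 ->
  nat_conv (law0 n p) (law0 m p) =1 law0 (n + m) p.
Proof.
move=> p01; apply: eq_prob_nat => k; rewrite nat_conv_set1 law0_set1//.
under eq_bigr do rewrite !law0_set1// -EFinM.
rewrite sumEFin; congr EFin; rewrite [RHS]/binomial_pmf -binomial.Vandermonde.
rewrite raddf_sum/=; apply: eq_bigr => i _; rewrite /binomial_pmf.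
have ik : (i <= k)%N by rewrite -ltnS.
(* When [n < i] or [m < k - i], truncated subtraction spoils the exponents, but a vanishing binomial
   coefficient kills the term on both sides. *)
have [ni|iln] := ltnP n i; first by rewrite bin_small// mul0n !mulr0n mul0r.
have [mki|kim] := ltnP m (k - i).
  by rewrite [in 'C(m, _)]bin_small// muln0 !mulr0n mulr0.
rewrite mulrnAl mulrnAr -mulrnA [X in _ *+ X]mulnC; congr (_ *+ _).
rewrite mulrACA -!exprD subnKC//; congr (_ * _ ^+ _); lia.
Qed.

Lemma nat_conv_poisson a b : 0 <= a -> 0 <= b ->
  nat_conv (poisson_law a) (poisson_law b) =1 poisson_law (a + b).
Proof.
move=> a0 b0; apply: eq_prob_nat => k.
rewrite nat_conv_set1 poisson_law_set1 ?addr_ge0//.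
under eq_bigr do rewrite !poisson_law_set1// -EFinM.
(* Expanding [(b + a) ^+ k] rather than [(a + b) ^+ k] gives [a] the exponent [i], as in the
   convolution sum. *)
rewrite sumEFin; congr EFin; rewrite addrC exprDn opprD expRD 2!mulr_suml.
apply: eq_bigr => i _.
have ik : (i <= k)%N by rewrite -ltnS.
have fact_neq0 j : j`!%:R != 0 :> R by rewrite pnatr_eq0 -lt0n fact_gt0.
(* Factoring [k!] through ['C(k, i)] cancels the coefficient from the binomial theorem. *)
rewrite -(bin_fact ik) !natrM -mulr_natr.
by field; rewrite !fact_neq0 pnatr_eq0 -lt0n bin_gt0.
Qed.

(** Bern(p) is represented as [law0 1 p], so that [nat_conv_binomial] applies to it. *)
Lemma law01E p A : 0 <= p <= 1 ->
  law0 1 p A = (p * \1_A 1%N + (1 - p) * \1_A 0%N)%:E.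
Proof.
move=> /andP[p0 p1]; rewrite /law0/= (@binomial_probE _ 1 p p0 p1).
rewrite 2!big_ord_recl big_ord0/= /bump/= !diracE !indicE adde0 -!EFinM -EFinD.
by congr EFin;
  rewrite addn0 subn0 subnn bin0 binn expr0 !expr1 !mulr1n mul1r mulr1 addrC.
Qed.

(** Discards the mass beyond 1. This loses nothing essential when [mu] is to dominate, up to an
    error, a law carried by 0 and 1. *)
Lemma prob_nat_ge01 (mu : probability nat R) A :
  (mu [set 0%N] * (\1_A 0%N)%:E + mu [set 1%N] * (\1_A 1%N)%:E <= mu A)%E.
Proof.
have le_mu B : B `<=` A -> (mu B <= mu A)%E.
  by move=> ?; rewrite le_measure ?inE.
rewrite !indicE; case: (boolP (0%N \in A)) => [|_];
  case: (boolP (1%N \in A)) => [|_] //.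
- rewrite !inE => A1 A0; rewrite !mule1 -measureU//; last first.
    by apply/seteqP; split => // x [/= ->].
  by apply: le_mu => x [/= ->|/= ->].
- by rewrite inE => A0; rewrite mule1 mule0 adde0; apply: le_mu => x /= ->.
- by rewrite inE => A1; rewrite mule1 mule0 add0e; apply: le_mu => x /= ->.
- by rewrite !mule0 adde0.
Qed.

(** At 0 the Poisson mass is the larger, as [1 - p <= expR (- p)]. The only excess of the Bernoulli
    law is at 1, and it equals [p - p * expR (- p)]. *)
Lemma tv_le_bernoulli_poisson p : 0 <= p <= 1 ->
  tv_le (law0 1 p) (poisson_law p) (p * (1 - expR (- p))).
Proof.
move=> /[dup] p01 /andP[p0 p1] A _; rewrite law01E//.
apply: le_trans (leeD2r _ (prob_nat_ge01 _ A)).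
rewrite !poisson_law_set1// -!EFinM -!EFinD lee_fin.
rewrite expr0 expr1 !divr1 mul1r mulrBr mulr1.
have e1 := expR_ge1Dx (- p).
have i0 : (\1_A 0%N : R) = 0 \/ (\1_A 0%N : R) = 1.
  by rewrite indicE; case: (_ \in _); [right|left].
have i1 : (\1_A 1%N : R) = 0 \/ (\1_A 1%N : R) = 1.
  by rewrite indicE; case: (_ \in _); [right|left].
have e0 : p * expR (- p) <= p by rewrite ler_piMr// -expR0 ler_expR oppr_le0.
have e2 := expR_ge0 (- p).
by case: i0 => ->; case: i1 => ->; lra.
Qed.

Lemma poisson_law0 : poisson_law (0 : R) =1 \d_0%N.
Proof. by move=> A; rewrite /poisson_law/= /poisson_prob ltxx. Qed.

(** The Dirac mass exceeds the Poisson law only at 0, by [1 - expR (- b) <= b]. *)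
Lemma tv_le_poisson0 b : 0 <= b -> tv_le (poisson_law 0) (poisson_law b) b.
Proof.
move=> b0 A _; apply: le_trans (leeD2r _ (prob_nat_ge01 _ A)).
rewrite poisson_law0 diracE !poisson_law_set1// !indicE -!EFinM -!EFinD lee_fin.
rewrite expr0 expr1 !divr1 mul1r.
have e1 := expR_ge1Dx (- b).
have e2 : 0 <= b * expR (- b) * (1%N \in A)%:R.
  by rewrite !mulr_ge0// expR_ge0.
by case: (_ \in A) => /=; lra.
Qed.

Lemma tv_le_poisson_add a b : 0 <= a -> 0 <= b ->
  tv_le (poisson_law a) (poisson_law (a + b)) b.
Proof.
move=> a0 b0.
apply: eq_tv_le (nat_conv_poisson a0 b0)
  (tv_le_nat_convr (poisson_law a) b0 (tv_le_poisson0 b0)).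
(* Poi(a) is its own convolution with Poi(0), so only the second factor has been changed. *)
by move=> A; rewrite nat_conv_poisson// addr0.
Qed.

Lemma tv_le_poisson a b : 0 <= a -> 0 <= b ->
  tv_le (poisson_law a) (poisson_law b) `|a - b|.
Proof.
move=> a0 b0; have [ab|/ltW ba] := leP a b.
  rewrite distrC ger0_norm ?subr_ge0//.
  by have := @tv_le_poisson_add a (b - a); rewrite subrKC subr_ge0; apply.
rewrite ger0_norm ?subr_ge0//; apply: tv_le_sym.
by have := @tv_le_poisson_add b (a - b); rewrite subrKC subr_ge0; apply.
Qed.

Lemma tv_le_binomial_poisson n p : 0 <= p <= 1 ->
  tv_le (law0 n p) (poisson_law (n%:R * p)) (n%:R * p * (1 - expR (- p))).
Proof.
move=> /[dup] p01 /andP[p0 p1].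
have f0 : 0 <= p * (1 - expR (- p)).
  by rewrite mulr_ge0// subr_ge0 -expR0 ler_expR oppr_le0.
elim: n => [|n IHn].
  (* With no trials both laws are the Dirac mass at 0. *)
  rewrite !mul0r => A _; rewrite adde0 poisson_law0.
  rewrite /law0/= (@binomial_probE _ 0 p p0 p1) big_ord_recl big_ord0/=.
  by rewrite adde0 subnn !expr0 mul1r mulr1n mul1e.
rewrite -natr1 !mulrDl !mul1r.
have np0 : 0 <= n%:R * p by rewrite mulr_ge0.
have := tv_le_nat_conv _ f0 IHn (tv_le_bernoulli_poisson p01).
rewrite -mulrA => /(_ (mulr_ge0 (ler0n _ _) f0)).
apply: eq_tv_le (nat_conv_poisson np0 p0) => A.
by rewrite nat_conv_binomial// addn1.
Qed.

(** The second summand of [law1] is [bool]-valued; trading it for [law0 1 (1 - p)] on [nat] makes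
    the convolution bounds available. *)
Lemma law1E n p : 0 <= p <= 1 ->
  nat_conv (law0 n.-1 p) (law0 1 (1 - p)) =1 law1 n p.
Proof.
move=> /andP[p0 p1] A; rewrite nat_convEl; apply: eq_integral => x _ /=.
have q01 : 0 <= 1 - p <= 1 by rewrite subr_ge0 p1 lerBlDr lerDl.
rewrite law01E// bernoulli_probE// !diracE !indicE EFinD !EFinM.
rewrite /unstable.onem.
by congr (_ * (nat_of_bool _)%:R%:E + _ * (nat_of_bool _)%:R%:E)%E;
  rewrite mem_xsection; apply/idP/idP => /set_mem H; exact/mem_set.
Qed.

Lemma shifted_poisson_lawE a :
  nat_conv (poisson_law a) \d_1%N =1 shifted_poisson_law a.
Proof.
move=> A; rewrite nat_convEr integral_dirac//= diracT mul1e.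
by congr (poisson_law a _); apply/seteqP; split => x /=; rewrite addn1.
Qed.

Lemma tv_le_bernoulli_dirac1 p : 0 <= p <= 1 ->
  tv_le (law0 1 (1 - p)) \d_1%N p.
Proof.
move=> /andP[p0 p1] A _.
have q01 : 0 <= 1 - p <= 1 by rewrite subr_ge0 p1 lerBlDr lerDl.
rewrite law01E//= diracE !indicE -EFinD lee_fin.
by case: (_ \in A); case: (_ \in A) => /=; lra.
Qed.

Lemma tv_le_law0 n p a : 0 <= p <= 1 -> 0 <= a ->
  tv_le (law0 n p) (poisson_law a)
    (n%:R * p * (1 - expR (- p)) + `|n%:R * p - a|).
Proof.
move=> p01 a0; apply: tv_le_trans (tv_le_binomial_poisson _ p01) _.
by apply: tv_le_poisson => //; rewrite mulr_ge0//; case/andP: p01.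
Qed.

Lemma tv_le_law1 n p a : 0 <= p <= 1 -> 0 <= a ->
  tv_le (law1 n p) (shifted_poisson_law a)
    (p + n.-1%:R * p * (1 - expR (- p)) + `|n.-1%:R * p - a|).
Proof.
move=> /[dup] p01 /andP[p0 p1] a0.
apply: (eq_tv_le (law1E n p01) (shifted_poisson_lawE a)).
(* The lone [p] pays for the second factor, Bern(1 - p) against the Dirac mass at 1; the rest pays
   for the first. *)
rewrite -addrA addrC; apply: tv_le_nat_conv => //.
- rewrite addr_ge0// mulr_ge0 ?mulr_ge0//.
  by rewrite subr_ge0 -expR0 ler_expR oppr_le0.
- exact: tv_le_law0.
- exact: tv_le_bernoulli_dirac1.
Qed.

End distributions.

(** * Bounds and asymptotics of the flip probability *)

Lemma flip_prob_bounds (R : realType) (eps : R) : 0 <= flip_prob eps <= 1.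
Proof.
have e0 := expR_ge0 eps; rewrite /flip_prob invr_ge0 addr_ge0//=.
by rewrite invf_le1 ?lerDl// ltr_wpDr.
Qed.

Lemma flip_prob_ge0 (R : realType) (eps : R) : 0 <= flip_prob eps.
Proof. by have /andP[] := flip_prob_bounds eps. Qed.

Lemma onem_expRN_le (R : realType) (x : R) : 1 - expR (- x) <= x.
Proof. by have := expR_ge1Dx (- x); lra. Qed.

(** For [n > 0], dividing through by [n] turns [n / (1 + expR (eps n))] into the inverse of
    [1 / n + expR (eps n) / n], which tends to [0 + l]. *)
Lemma cvg_mulrn_flip_prob (R : realType) (l : R) (eps : nat -> R) : l != 0 ->
  expR (eps n) / n%:R @[n --> \oo] --> l ->
  n%:R * flip_prob (eps n) @[n --> \oo] --> l^-1.
Proof.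
move=> l0 epsl.
have cvg_inv : (n%:R^-1 + expR (eps n) / n%:R)^-1 @[n --> \oo] --> (0 + l)^-1.
  apply: cvgV; first by rewrite add0r.
  apply: cvgD epsl; apply/gtr0_cvgV0; last exact: cvgr_idn.
  by near=> n; rewrite ltr0n; near: n; exact: nbhs_infty_gt.
rewrite -[l]add0r; apply: cvg_trans cvg_inv; apply: near_eq_cvg; near=> n.
have n0 : (n%:R : R) != 0.
  by rewrite pnatr_eq0 -lt0n; near: n; exact: nbhs_infty_gt.
have e0 : 1 + expR (eps n) != 0 by rewrite gt_eqF// ltr_wpDr ?expR_ge0.
by rewrite /flip_prob; field; rewrite e0 n0.
Unshelve. all: by end_near. Qed.

Theorem theorem3p1 (R : realType) (c : R) (eps0 : nat -> R)
    (c_gt0 : 0 < c)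
    (eps0_gt0 : forall n : nat, (1 <= n)%N -> 0 < eps0 n)
    (eps0_cvg : expR (eps0 n) / n%:R @[n --> \oo] --> c ^+ 2) :
  let delta (n : nat) : R := flip_prob (eps0 n) in
  let lambda : R := (c ^+ 2)^-1 in
  let P (n : nat) := law0 n (delta n) in
  let Q (n : nat) := law1 n (delta n) in
  let Pinf := poisson_law lambda in
  let Qinf := shifted_poisson_law lambda in
  let Delta (n : nat) : R := le_cam (P n, Q n) (Pinf, Qinf) in
  [/\ Delta n @[n --> \oo] --> (0 : R),
      forall n : nat, (1 <= n)%N ->
        tv (P n) Pinf
          <= n%:R * delta n * (1 - expR (- delta n))
             + `|n%:R * delta n - lambda|
          <= n%:R * delta n ^+ 2 + `|n%:R * delta n - lambda|,
      forall n : nat, (1 <= n)%N ->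
        tv (Q n) Qinf
          <= delta n + n.-1%:R * delta n * (1 - expR (- delta n))
             + `|n.-1%:R * delta n - lambda|
          <= delta n + n.-1%:R * delta n ^+ 2 + `|n.-1%:R * delta n - lambda|,
      forall n : nat, (1 <= n)%N ->
        Delta n <= Num.max (tv (P n) Pinf) (tv (Q n) Qinf) &
      forall n : nat, (1 <= n)%N -> expR (eps0 n) = c ^+ 2 * n%:R ->
        Delta n <= 2 / (c ^+ 2 * n%:R) + 2 / (c ^+ 4 * n%:R)].
Proof.
move=> delta lambda P Q Pinf Qinf Delta.
have d01 n : 0 <= delta n <= 1 := flip_prob_bounds (eps0 n).
have d0 n : 0 <= delta n := flip_prob_ge0 (eps0 n).
have l0 : 0 <= lambda by rewrite invr_ge0 exprn_ge0// ltW.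
have expd n := onem_expRN_le (delta n).
have tvP n : tv (P n) Pinf <= n%:R * delta n * (1 - expR (- delta n))
    + `|n%:R * delta n - lambda|.
  exact/tv_le_tv/tv_le_law0.
have tvP' n : n%:R * delta n * (1 - expR (- delta n))
    + `|n%:R * delta n - lambda|
    <= n%:R * delta n ^+ 2 + `|n%:R * delta n - lambda|.
  by rewrite lerD2r expr2 mulrA ler_wpM2l// mulr_ge0.
have tvQ n : tv (Q n) Qinf <= delta n
    + n.-1%:R * delta n * (1 - expR (- delta n))
    + `|n.-1%:R * delta n - lambda|.
  exact/tv_le_tv/tv_le_law1.
have tvQ' n : delta n + n.-1%:R * delta n * (1 - expR (- delta n))
    + `|n.-1%:R * delta n - lambda|
    <= delta n + n.-1%:R * delta n ^+ 2 + `|n.-1%:R * delta n - lambda|.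
  by rewrite lerD2r lerD2l expr2 mulrA ler_wpM2l// mulr_ge0.
have Delta_le n : Delta n <= Num.max (tv (P n) Pinf) (tv (Q n) Qinf).
  exact: le_cam_le_tv.
have predn_delta n : (1 <= n)%N ->
    n.-1%:R * delta n = n%:R * delta n - delta n.
  by case: n => // n _; rewrite -natr1 mulrDl mul1r addrK.
(* One bound for both pairs of laws, serving the limit and the explicit rate alike. The last
   [delta n] pays for replacing [n.-1] by [n] inside the absolute value. *)
have Delta_le' n : (1 <= n)%N -> Delta n <=
    delta n + n%:R * delta n * delta n
    + `|n%:R * delta n - lambda| + delta n.
  move=> n1; apply: le_trans (Delta_le n) _; rewrite ge_max; apply/andP; split.
    apply: le_trans (tvP n) (le_trans (tvP' n) _); rewrite expr2 mulrA.
    by have := d0 n; lra.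
  apply: le_trans (tvQ n) (le_trans (tvQ' n) _).
  rewrite expr2 mulrA predn_delta// mulrBl.
  have := ler_normB (n%:R * delta n - lambda) (delta n).
  rewrite (ger0_norm (d0 n)) addrAC.
  by have := mulr_ge0 (d0 n) (d0 n); lra.
split => //.
- have ndelta : n%:R * delta n @[n --> \oo] --> lambda.
    by apply: cvg_mulrn_flip_prob => //; rewrite gt_eqF// exprn_gt0.
  have delta0 : delta n @[n --> \oo] --> 0.
    (* [delta n] is eventually the product of the convergent [n * delta n] and the vanishing
       [1 / n]. *)
    have cvg_inv : n%:R * delta n * n%:R^-1 @[n --> \oo] --> lambda * 0.
      apply: cvgM ndelta _; apply/gtr0_cvgV0; last exact: cvgr_idn.
      by near=> n; rewrite ltr0n; near: n; exact: nbhs_infty_gt.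
    rewrite -(mulr0 lambda); apply: cvg_trans cvg_inv; apply: near_eq_cvg.
    near=> n; rewrite mulrAC mulfV ?mul1r// pnatr_eq0 -lt0n.
    by near: n; exact: nbhs_infty_gt.
  apply: (@squeeze_cvgr _ _ _ _ (fun=> 0) (fun n => delta n
      + n%:R * delta n * delta n + `|n%:R * delta n - lambda| + delta n)).
  + near=> n; rewrite le_cam_ge0 Delta_le'//.
    by near: n; exact: nbhs_infty_gt.
  + exact: cvg_cst.
  + have -> : 0 = 0 + lambda * 0 + `|lambda - lambda| + 0 :> R.
      by rewrite subrr normr0 mulr0 !addr0.
    apply: (cvgD _ delta0); apply: cvgD.
      by apply: (cvgD delta0); exact: cvgM.
    by apply: cvg_norm; apply: cvgB ndelta _; exact: cvg_cst.
- by move=> n _; rewrite tvP tvP'.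
- by move=> n _; rewrite tvQ tvQ'.
- move=> n n1 epsE; apply: le_trans (Delta_le' n n1) _.
  have n0 : (0 : R) < n%:R by rewrite ltr0n.
  have c20 : 0 < c ^+ 2 by rewrite exprn_gt0.
  have -> : delta n = (1 + c ^+ 2 * n%:R)^-1 by rewrite /delta/flip_prob epsE.
  (* With [k = c ^+ 2], [x = n] and [d = 1 / (1 + k * x)], the quantity to bound is
     [2 * d + x * d * d + |x * d - 1 / k|]. Each of the last two terms is at most [d / k], and
     [d <= 1 / (k * x)]. *)
  rewrite /lambda -[4%N]/(2 * 2)%N exprM; move: (c ^+ 2) (n%:R : R) c20 n0.
  move=> k x k0 x0.
  have kx : 0 < k * x by rewrite mulr_gt0.
  have d_le : (1 + k * x)^-1 <= (k * x)^-1 by rewrite lef_pV2 ?posrE; lra.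
  set d := (1 + k * x)^-1 in d_le *.
  have dge0 : 0 <= d by rewrite invr_ge0; lra.
  have xd_le : x * d <= k^-1.
    rewrite (le_trans (ler_wpM2l (ltW x0) d_le))//.
    by rewrite invfM mulrCA mulfV ?mulr1// gt_eqF.
  have -> : `|x * d - k^-1| = k^-1 * d.
    rewrite distrC ger0_norm ?subr_ge0//.
    by rewrite /d; field; rewrite !gt_eqF//; lra.
  have -> : 2 / (k * x) + 2 / (k ^+ 2 * x) =
      2 * (k * x)^-1 + 2 * (k^-1 * (k * x)^-1).
    by field; rewrite !gt_eqF.
  have cd : k^-1 * d <= k^-1 * (k * x)^-1 by rewrite ler_wpM2l// invr_ge0 ltW.
  have xdd : x * d * d <= k^-1 * d by rewrite ler_wpM2r.
  by lra.
Unshelve. all: by end_near. Qed.
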